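(* Let $L$ be an indexed language over an alphabet $A$ and let $B\subseteq A$. If $B$ is rare in $L$, then $B$ is nonfrequent in $L$.
   Context: Indexed languages are the languages generated by indexed grammars (Aho's grammars in which nonterminals carry stacks that can be pushed, popped and copied). For a word $w$ and $B\subseteq A$, $\#_B(w)$ is the number of occurrences in $w$ of symbols from $B$. $B$ is nonfrequent in $L$ if there is a constant $c_B$ with $\#_B(w)\le c_B$ for all $w\in L$, and frequent otherwise. $B$ is rare in $L$ if for every $k\ge1$ there is $n_k\ge1$ such that for all $w\in L$ with $\#_B(w)\ge n_k$, any two distinct occurrences in $w$ of symbols from $B$ are at positions whose difference is at least $k$. *)

(* Defs.v *)
From Stdlib Require List.
From mathcomp Require Import all_boot.
Set Implicit Arguments. Unset Strict Implicit. Unset Printing Implicit Defensive.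

(* Indexed grammars in the standard (Hopcroft–Ullman) presentation, equivalent
   to Aho's original definition.  A grammar over terminal alphabet A has a
   finite set of nonterminals N, a finite set of flags (index symbols) F,
   a start symbol and a finite list of productions of three kinds:
     A -> alpha        (the stack of A is copied to every nonterminal of alpha)
     A -> B f          (push f on the stack)
     A f -> alpha      (pop f, the rest of the stack is copied to alpha)
   where alpha is a word over N + A. *)

Section IndexedGrammar.
Variables (N F A : Type).

Inductive iprod :=
  | PCopy of N & seq (N + A)
  | PPush of N & N & F
  | PPop of N & F & seq (N + A).

Inductive isym :=
  | NT of N & seq F
  | Tm of A.

Definition inst (st : seq F) (rhs : seq (N + A)) : seq isym :=
  map (fun s => match s with inl Y => NT Y st | inr a => Tm a end) rhs.

Variable P : seq iprod.

Inductive istep : seq isym -> seq isym -> Prop :=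
  | step_copy u v X st rhs :
      List.In (PCopy X rhs) P ->
      istep (u ++ NT X st :: v) (u ++ inst st rhs ++ v)
  | step_push u v X Y f st :
      List.In (PPush X Y f) P ->
      istep (u ++ NT X st :: v) (u ++ NT Y (f :: st) :: v)
  | step_pop u v X f st rhs :
      List.In (PPop X f rhs) P ->
      istep (u ++ NT X (f :: st) :: v) (u ++ inst st rhs ++ v).

Inductive iderives : seq isym -> seq isym -> Prop :=
  | der_refl s : iderives s s
  | der_step s t r : istep s t -> iderives t r -> iderives s r.

End IndexedGrammar.

Record igrammar (A : finType) := IGrammar {
  ig_nt : finType;
  ig_flag : finType;
  ig_start : ig_nt;
  ig_prods : seq (iprod ig_nt ig_flag A) }.

Definition generates (A : finType) (G : igrammar A) (w : seq A) : Prop :=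
  iderives (ig_prods G) [:: @NT _ (ig_flag G) A (ig_start G) [::]] (map (@Tm (ig_nt G) (ig_flag G) A) w).

Definition indexed_language (A : finType) (L : seq A -> Prop) : Prop :=
  exists G : igrammar A, forall w, L w <-> generates G w.

Definition occB (A : finType) (B : {set A}) (w : seq A) : nat :=
  count (fun a => a \in B) w.

Definition nonfrequent (A : finType) (L : seq A -> Prop) (B : {set A}) : Prop :=
  exists c : nat, forall w, L w -> occB B w <= c.

(* Positions are 0-based indices into w; nth uses w's own first letter as
   default, which is irrelevant since i, j < size w. *)
Definition rare (A : finType) (L : seq A -> Prop) (B : {set A}) : Prop :=
  forall k : nat, 1 <= k ->
    exists nk : nat, 1 <= nk /\
      forall w, L w -> nk <= occB B w ->
        forall (a0 : A) (i j : nat), i < j -> j < size w ->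
          nth a0 w i \in B -> nth a0 w j \in B -> k <= j - i.

(* Main.v *)
(* A derivation tree with many letters of [B] has a path along which many steps
   are marked, i.e. have a sibling yielding a letter of [B].  Attach to a stack
   the sets of nonterminals that, with this stack, derive some word,
   respectively some word meeting [B]; replacing the bottom of all stacks by one
   of the same type keeps derivations and their marks.  On a path with enough
   marks, the pigeonhole principle yields either
     X[t] => u X[bt] v   or   Y[t] => x Y[bt] y, Y[bt] => x' X[bt] y',
                              X[bt] => u X[t] v
   with [t] and [bt] of the same type and a letter of [B] in [uv].  Pumping [b]
   produces arbitrarily many letters of [B], while the two copies of [u] (or of
   [v]) whose stacks are nearest to [t] stay the same, so two letters of [B]
   remain at bounded distance: [B] is not rare. *)

From mathcomp Require Import all_boot boolp zify.
Require Import Defs.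
Set Implicit Arguments. Unset Strict Implicit. Unset Printing Implicit Defensive.

Lemma card_setC_add (T : finType) (x : T) (V : {set T}) :
  x \notin V -> #|~: V| = #|~: (x |: V)|.+1.
Proof.
move=> nx; have := cardsC V; have := cardsC (x |: V).
by rewrite cardsU1 nx; lia.
Qed.

(** * Big-step derivations *)

Section Derivations.
Variables (N F A : finType) (P : seq (iprod N F A)) (B : {set A}).

Local Notation form := (seq (isym N F A)).
Local Notation nt X st := (@NT N F A X st).
Local Notation tm a := (@Tm N F A a).
Local Notation ist st r := (@inst N F A st r).

Definition hasB (w : seq A) : bool := has (mem B) w.

Lemma hasB_cat u v : hasB (u ++ v) = hasB u || hasB v.
Proof. exact: has_cat. Qed.

Lemma occB_cat u v : occB B (u ++ v) = occB B u + occB B v.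
Proof. exact: count_cat. Qed.

Lemma hasB_occ w : hasB w = (0 < occB B w).
Proof. exact: has_count. Qed.

(** Big-step derivations: every symbol of the form yields its own factor of the word, so induction
    follows the derivation tree. *)
Inductive gen : form -> seq A -> Prop :=
  | gen_nil : gen [::] [::]
  | gen_tm a s w : gen s w -> gen (tm a :: s) (a :: w)
  | gen_copy X st rhs s w1 w2 :
      List.In (PCopy F X rhs) P -> gen (ist st rhs) w1 -> gen s w2 ->
      gen (nt X st :: s) (w1 ++ w2)
  | gen_push X Y f st s w1 w2 :
      List.In (PPush A X Y f) P -> gen [:: nt Y (f :: st)] w1 -> gen s w2 ->
      gen (nt X st :: s) (w1 ++ w2)
  | gen_pop X f st rhs s w1 w2 :
      List.In (PPop X f rhs) P -> gen (ist st rhs) w1 -> gen s w2 ->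
      gen (nt X (f :: st) :: s) (w1 ++ w2).

Lemma gen_cat s t u v : gen s u -> gen t v -> gen (s ++ t) (u ++ v).
Proof.
move=> Hs Ht; elim: Hs => {s u} //=.
- by move=> a s w _ IH; apply: gen_tm.
- by move=> X st rhs s w1 w2 HP H1 _ _ IH; rewrite -catA; apply: gen_copy HP H1 IH.
- by move=> X Y f st s w1 w2 HP H1 _ _ IH; rewrite -catA; apply: gen_push HP H1 IH.
- by move=> X f st rhs s w1 w2 HP H1 _ _ IH; rewrite -catA; apply: gen_pop HP H1 IH.
Qed.

Lemma gen_consP x s w :
  gen (x :: s) w -> exists u v, [/\ w = u ++ v, gen [:: x] u & gen s v].
Proof.
move Et: (x :: s) => t H; case: H Et => //.
- move=> a s' w' H [-> ->]; exists [:: a], w'; split=> //.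
  exact: gen_tm gen_nil.
- move=> X st rhs s' w1 w2 HP H1 H2 [-> ->]; exists w1, w2; split=> //.
  by rewrite -[w1]cats0; apply: gen_copy HP H1 gen_nil.
- move=> X Y f st s' w1 w2 HP H1 H2 [-> ->]; exists w1, w2; split=> //.
  by rewrite -[w1]cats0; apply: gen_push HP H1 gen_nil.
- move=> X f st rhs s' w1 w2 HP H1 H2 [-> ->]; exists w1, w2; split=> //.
  by rewrite -[w1]cats0; apply: gen_pop HP H1 gen_nil.
Qed.

Lemma gen_catP s t w :
  gen (s ++ t) w -> exists u v, [/\ w = u ++ v, gen s u & gen t v].
Proof.
elim: s w => [|x s IH] w /= H.
- by exists [::], w; split=> //; apply: gen_nil.
- have [u [v [-> Hu Hv]]] := gen_consP H.
  have [u' [v' [-> Hu' Hv']]] := IH _ Hv.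
  exists (u ++ u'), v'; split=> //; first by rewrite catA.
  exact: (gen_cat Hu Hu').
Qed.

Lemma gen_step s t w : istep P s t -> gen t w -> gen s w.
Proof.
case=> {s t} u v X.
- move=> st rhs HP /gen_catP [w1 [w' [-> H1 /gen_catP [w2 [w3 [-> H2 H3]]]]]].
  by apply: gen_cat => //; apply: gen_copy HP H2 H3.
- move=> Y f st HP /gen_catP [w1 [w' [-> H1]]].
  rewrite -cat1s => /gen_catP [w2 [w3 [-> H2 H3]]].
  by apply: gen_cat => //; apply: gen_push HP H2 H3.
- move=> f st rhs HP /gen_catP [w1 [w' [-> H1 /gen_catP [w2 [w3 [-> H2 H3]]]]]].
  by apply: gen_cat => //; apply: gen_pop HP H2 H3.
Qed.

Lemma iderives_trans s t r : iderives P s t -> iderives P t r -> iderives P s r.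
Proof. by elim=> // {}s {}t t' st _ IH /IH; apply: der_step. Qed.

Lemma istep_ctx a b s t : istep P s t -> istep P (a ++ s ++ b) (a ++ t ++ b).
Proof.
case=> {s t} u v X.
- by move=> st rhs HP; rewrite -!catA !cat_cons !(catA a u); apply: step_copy.
- by move=> Y f st HP; rewrite -!catA !cat_cons !(catA a u); apply: step_push.
- by move=> f st rhs HP; rewrite -!catA !cat_cons !(catA a u); apply: step_pop.
Qed.

Lemma iderives_ctx a b s t :
  iderives P s t -> iderives P (a ++ s ++ b) (a ++ t ++ b).
Proof.
elim=> {s t} [s|s t r st _ IH]; first exact: der_refl.
exact: der_step (istep_ctx a b st) IH.
Qed.

Lemma gen_iderives s w : gen s w -> iderives P s (map (@Tm N F A) w).
Proof.
have glue X st t s' w1 w2 : (forall v, istep P (nt X st :: v) (t ++ v)) ->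
    iderives P t (map (@Tm N F A) w1) ->
    iderives P s' (map (@Tm N F A) w2) ->
    iderives P (nt X st :: s') (map (@Tm N F A) (w1 ++ w2)).
  move=> Hst H1 H2; rewrite map_cat.
  apply: der_step (Hst _) _; apply: iderives_trans (iderives_ctx [::] s' H1) _.
  by move: (iderives_ctx (map (@Tm N F A) w1) [::] H2); rewrite !cats0.
elim=> {s w} /=.
- exact: der_refl.
- move=> a s w _ IH.
  by move: (iderives_ctx [:: tm a] [::] IH); rewrite !cats0.
- move=> X st rhs s w1 w2 HP _ IH1 _ IH2; apply: glue IH1 IH2 => v.
  exact: (@step_copy _ _ _ P [::] v).
- move=> X Y f st s w1 w2 HP _ IH1 _ IH2; apply: glue IH1 IH2 => v.
  exact: (@step_push _ _ _ P [::] v).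
- move=> X f st rhs s w1 w2 HP _ IH1 _ IH2; apply: glue IH1 IH2 => v.
  exact: (@step_pop _ _ _ P [::] v).
Qed.

Lemma iderives_gen s w : iderives P s (map (@Tm N F A) w) -> gen s w.
Proof.
move Et: (map _ w) => t H; elim: H Et => {s t}.
- move=> s <-; elim: w => [|a w IH]; [exact: gen_nil | exact: gen_tm].
- by move=> s t r st _ IH /IH; apply: gen_step.
Qed.

(** * Stack types and replacement of the bottom of a stack *)

(* The type of a stack records what its nonterminals can still achieve: some
   terminal word, and some terminal word meeting [B]. *)
Definition typ (st : seq F) : {set N} * {set N} :=
  ([set X | `[< exists w, gen [:: nt X st] w >]],
   [set X | `[< exists2 w, gen [:: nt X st] w & hasB w >]]).

Definition typ_le (st st' : seq F) : Prop :=
  forall X w, gen [:: nt X st] w ->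
  exists2 w', gen [:: nt X st'] w' & hasB w -> hasB w'.

Lemma typ_eq_le st st' : typ st = typ st' -> typ_le st st'.
Proof.
move=> [E1 E2] X w Hw; have [hw|hw] := boolP (hasB w).
- have: X \in (typ st).2 by rewrite inE; apply/asboolP; exists w.
  by rewrite /typ E2 inE => /asboolP [w' Hw' hw']; exists w'.
- have: X \in (typ st).1 by rewrite inE; apply/asboolP; exists w.
  by rewrite /typ E1 inE => /asboolP [w' Hw']; exists w'.
Qed.

Definition shift (t : seq F) (s : isym N F A) : isym N F A :=
  match s with NT X sg => nt X (sg ++ t) | Tm a => tm a end.

Lemma inst_shift sg t rhs : ist (sg ++ t) rhs = map (shift t) (ist sg rhs).
Proof. by rewrite /inst -map_comp; apply: eq_map => -[]. Qed.

(** The same productions apply as long as only the part of a stack above [t] is consulted. A subtree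
    whose root pops into [t] starts at a nonterminal with stack exactly [t], so [typ_le] supplies a
    replacement for it. *)
Lemma gen_transfer t t' rs w : typ_le t t' -> gen (map (shift t) rs) w ->
  exists2 w', gen (map (shift t') rs) w' & hasB w -> hasB w'.
Proof.
move=> le; move Es: (map _ rs) => s H.
elim: H rs Es => {s w}.
- by case=> // _; exists [::] => //; apply: gen_nil.
- move=> a s w _ IH [|[//|b] rs] //= [-> /IH [w' Hw' hw']].
  exists (a :: w'); first exact: gen_tm.
  by rewrite /hasB /=; case: (a \in B).
- move=> X st rhs s w1 w2 HP H1 IH1 _ IH2 [|[Y sg|//] rs] //= [-> Est /IH2].
  have [w1' Hw1' hw1'] := IH1 _ (esym (etrans (f_equal (fun z => ist z rhs)
    (esym Est)) (inst_shift sg t rhs))).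
  case=> w2' Hw2' hw2'; exists (w1' ++ w2').
    by apply: gen_copy HP _ Hw2'; rewrite inst_shift.
  by rewrite !hasB_cat => /orP [/hw1'|/hw2'] ->; rewrite ?orbT.
- move=> X Z f st s w1 w2 HP H1 IH1 _ IH2 [|[Y sg|//] rs] //= [-> Est /IH2].
  have [|w1' Hw1' hw1'] := IH1 [:: nt Z (f :: sg)]; first by rewrite -Est.
  case=> w2' Hw2' hw2'; exists (w1' ++ w2'); first exact: gen_push HP Hw1' Hw2'.
  by rewrite !hasB_cat => /orP [/hw1'|/hw2'] ->; rewrite ?orbT.
- move=> X f st rhs s w1 w2 HP H1 IH1 _ IH2 [|[Y sg|//] rs] //= [-> Est /IH2].
  case=> w2' Hw2' hw2'.
  suff [w1' Hw1' hw1'] : exists2 w', gen [:: nt X (sg ++ t')] w' & hasB w1 -> hasB w'.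
    exists (w1' ++ w2'); first exact: (gen_cat Hw1' Hw2').
    by rewrite !hasB_cat => /orP [/hw1'|/hw2'] ->; rewrite ?orbT.
  case: sg Est => [|g sg] /= Est.
    by apply: le; rewrite Est -[w1]cats0; apply: gen_pop HP H1 gen_nil.
  case: Est => Eg Est; subst g.
  have [|w1' Hw1' hw1'] := IH1 (ist sg rhs); first by rewrite -inst_shift Est.
  exists w1' => //; rewrite -[w1']cats0; apply: gen_pop HP _ gen_nil.
  by rewrite inst_shift.
Qed.

Lemma typ_le_cat sg t t' : typ_le t t' -> typ_le (sg ++ t) (sg ++ t').
Proof. by move=> le X w; apply: (@gen_transfer _ _ [:: nt X sg]). Qed.

(** * Paths in derivation trees *)

(* [ctx t X sg Y sg' u v]: a path of a derivation tree from [X] with stack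
   [sg ++ t] to [Y] with stack [sg' ++ t] that never pops into [t]; [u] and [v]
   are the words derived to the left and to the right of the path. *)
Inductive ctx (t : seq F) : N -> seq F -> N -> seq F -> seq A -> seq A -> Prop :=
  | ctx_nil X sg : ctx t X sg X sg [::] [::]
  | ctx_copy X r1 Z r2 sg u1 v1 Y sg' u v :
      List.In (PCopy F X (r1 ++ inl Z :: r2)) P ->
      gen (ist (sg ++ t) r1) u1 -> gen (ist (sg ++ t) r2) v1 ->
      ctx t Z sg Y sg' u v -> ctx t X sg Y sg' (u1 ++ u) (v ++ v1)
  | ctx_push X Z f sg Y sg' u v :
      List.In (PPush A X Z f) P ->
      ctx t Z (f :: sg) Y sg' u v -> ctx t X sg Y sg' u v
  | ctx_pop X f r1 Z r2 sg u1 v1 Y sg' u v :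
      List.In (PPop X f (r1 ++ inl Z :: r2)) P ->
      gen (ist (sg ++ t) r1) u1 -> gen (ist (sg ++ t) r2) v1 ->
      ctx t Z sg Y sg' u v -> ctx t X (f :: sg) Y sg' (u1 ++ u) (v ++ v1).

Lemma ctx_trans t X sg Y sg' Z sg'' u v u' v' :
  ctx t X sg Y sg' u v -> ctx t Y sg' Z sg'' u' v' ->
  ctx t X sg Z sg'' (u ++ u') (v' ++ v).
Proof.
move=> H H'; elim: H H' => {X sg Y sg' u v}.
- by move=> X sg; rewrite cats0.
- move=> X r1 W r2 sg u1 v1 Y sg' u v HP H1 H2 _ IH /IH H.
  by rewrite -catA (catA v'); apply: ctx_copy HP H1 H2 H.
- by move=> X W f sg Y sg' u v HP _ IH /IH; apply: ctx_push HP.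
- move=> X f r1 W r2 sg u1 v1 Y sg' u v HP H1 H2 _ IH /IH H.
  by rewrite -catA (catA v'); apply: ctx_pop HP H1 H2 H.
Qed.

(** [b] moves from the untouched bottom to the part that may be popped, so that paths over different
    bottoms can be composed. *)
Lemma ctx_rebase b t X sg Y sg' u v :
  ctx (b ++ t) X sg Y sg' u v -> ctx t X (sg ++ b) Y (sg' ++ b) u v.
Proof.
elim=> {X sg Y sg' u v}.
- by move=> X sg; apply: ctx_nil.
- move=> X r1 Z r2 sg u1 v1 Y sg' u v HP; rewrite catA => H1 H2 _ IH.
  exact: ctx_copy HP H1 H2 IH.
- by move=> X Z f sg Y sg' u v HP _ IH; apply: ctx_push HP IH.
- move=> X f r1 Z r2 sg u1 v1 Y sg' u v HP; rewrite catA => H1 H2 _ IH.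
  exact: ctx_pop HP H1 H2 IH.
Qed.

Lemma gen_inst_mid st r1 Z r2 u w v :
  gen (ist st r1) u -> gen [:: nt Z st] w -> gen (ist st r2) v ->
  gen (ist st (r1 ++ inl Z :: r2)) (u ++ w ++ v).
Proof.
by move=> Hu Hw Hv; rewrite /inst map_cat; apply: gen_cat (gen_cat Hw Hv).
Qed.

Lemma ctx_gen t X sg Y sg' u v w : ctx t X sg Y sg' u v ->
  gen [:: nt Y (sg' ++ t)] w -> gen [:: nt X (sg ++ t)] (u ++ w ++ v).
Proof.
move=> H; elim: H w => {X sg Y sg' u v}.
- by move=> X sg w; rewrite cats0.
- move=> X r1 Z r2 sg u1 v1 Y sg' u v HP H1 H2 _ IH w /IH Hw.
  have H := gen_copy HP (gen_inst_mid H1 Hw H2) gen_nil.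
  by move: H; rewrite cats0 -!catA.
- move=> X Z f sg Y sg' u v HP _ IH w /IH Hw.
  by move: (gen_push HP Hw gen_nil); rewrite cats0.
- move=> X f r1 Z r2 sg u1 v1 Y sg' u v HP H1 H2 _ IH w /IH Hw.
  have H := gen_pop HP (gen_inst_mid H1 Hw H2) gen_nil.
  by move: H; rewrite cats0 -!catA.
Qed.

(** The path never looks into [t], so it is kept; only its side trees change, by [gen_transfer]. *)
Lemma ctx_transfer t t' X sg Y sg' u v :
  typ_le t t' -> ctx t X sg Y sg' u v ->
  exists u' v', [/\ ctx t' X sg Y sg' u' v', hasB u -> hasB u' & hasB v -> hasB v'].
Proof.
move=> le; elim=> {X sg Y sg' u v}.
- by move=> X sg; exists [::], [::]; split=> //; apply: ctx_nil.
- move=> X r1 Z r2 sg u1 v1 Y sg' u v HP; rewrite !inst_shift.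
  move=> /(gen_transfer le) [u1' Hu1 hu1] /(gen_transfer le) [v1' Hv1 hv1] _.
  case=> u' [v' [H hu hv]]; exists (u1' ++ u'), (v' ++ v1'); split.
  + by apply: ctx_copy HP _ _ H; rewrite inst_shift.
  + by rewrite !hasB_cat => /orP [/hu1|/hu] ->; rewrite ?orbT.
  + by rewrite !hasB_cat => /orP [/hv|/hv1] ->; rewrite ?orbT.
- move=> X Z f sg Y sg' u v HP _ [u' [v' [H hu hv]]]; exists u', v'; split=> //.
  exact: ctx_push HP H.
- move=> X f r1 Z r2 sg u1 v1 Y sg' u v HP; rewrite !inst_shift.
  move=> /(gen_transfer le) [u1' Hu1 hu1] /(gen_transfer le) [v1' Hv1 hv1] _.
  case=> u' [v' [H hu hv]]; exists (u1' ++ u'), (v' ++ v1'); split.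
  + by apply: ctx_pop HP _ _ H; rewrite inst_shift.
  + by rewrite !hasB_cat => /orP [/hu1|/hu] ->; rewrite ?orbT.
  + by rewrite !hasB_cat => /orP [/hv|/hv1] ->; rewrite ?orbT.
Qed.

(** * The two pumping arguments *)

Section NoPump.
Variable S : N.

Definition reach (X : N) (t : seq F) : Prop :=
  exists x y, ctx [::] S [::] X t x y.

Lemma reach_ctx X t Y b u v :
  reach X t -> ctx t X [::] Y b u v -> reach Y (b ++ t).
Proof.
move=> [x [y H]]; rewrite -{1}[t]cats0 => /ctx_rebase H'.
by exists (x ++ u), (v ++ y); apply: ctx_trans H H'.
Qed.

Lemma reach_gen X t : reach X t ->
  exists x y, forall w, gen [:: nt X t] w -> gen [:: nt S [::]] (x ++ w ++ y).
Proof.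
move=> [x [y H]]; exists x, y => w Hw; apply: (ctx_gen H).
by rewrite cats0.
Qed.

(** The form in which rarity is used: a factor with two letters of [B] fixes a distance between
    them, hence bounds the letters of [B] in every word containing it. *)
Hypothesis no_pump : forall g, 1 < occB B g -> exists n, forall p q,
  gen [:: nt S [::]] (p ++ g ++ q) -> occB B (p ++ g ++ q) < n.

Lemma typ_le_refl t : typ_le t t.
Proof. by move=> X w Hw; exists w. Qed.

Lemma typ_le_trans t t' t'' : typ_le t t' -> typ_le t' t'' -> typ_le t t''.
Proof.
move=> H H' X w /H [w' /H' [w'' Hw'' h''] h']; exists w'' => //.
by move=> /h' /h''.
Qed.

Lemma typ_le_iter b t n : typ_le t (b ++ t) -> typ_le t (iter n (cat b) t).
Proof.
move=> le; elim: n => [|n IH] /=; first exact: typ_le_refl.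
by apply: (typ_le_trans le); apply: typ_le_cat.
Qed.

Lemma pump_false u v :
  1 < occB B u \/ 1 < occB B v ->
  (forall n, exists p' q' m, [/\ gen [:: nt S [::]] (p' ++ u ++ m ++ v ++ q')
     & n <= occB B (p' ++ m ++ q')]) -> False.
Proof.
move=> [] /no_pump [n Hn] /(_ n) [p' [q' [m [H le]]]].
- move: (Hn p' (m ++ v ++ q') H); move: le; rewrite !occB_cat; lia.
- have := Hn (p' ++ u ++ m) q'; rewrite -!catA => /(_ H).
  by move: le; rewrite !occB_cat; lia.
Qed.

(** The path is replayed at every height, since each [T j] can do what [t] can. The two lowest
    copies yield a fixed factor with two letters of [B], the [n] copies above them yield [n] more
    letters. *)
Lemma up_pump X t b u v w :
  reach X t -> ctx t X [::] X b u v -> hasB u || hasB v ->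
  typ_le t (b ++ t) -> gen [:: nt X (b ++ t)] w -> False.
Proof.
move=> rX H hB le Hw; pose T n := iter n (cat b) t.
have chain n : forall j, exists u' v',
    [/\ forall w, gen [:: nt X (T (n + j))] w -> gen [:: nt X (T j)] (u' ++ w ++ v'),
        hasB u -> n <= occB B u' & hasB v -> n <= occB B v'].
  elim: n => [|n IH] j.
    by exists [::], [::]; split=> // w'; rewrite cats0.
  have [u1 [v1 [/ctx_gen H1 hu1 hv1]]] := ctx_transfer (typ_le_iter j le) H.
  have [u2 [v2 [H2 hu2 hv2]]] := IH j.+1.
  exists (u1 ++ u2), (v2 ++ v1); split.
  + move=> w'; rewrite addSnnS => /H2 /H1; by rewrite -!catA.
  + move=> h; move: (hu1 h) (hu2 h); rewrite hasB_occ occB_cat; lia.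
  + move=> h; move: (hv1 h) (hv2 h); rewrite hasB_occ occB_cat; lia.
have [x [y Hxy]] := reach_gen rX.
(* Two levels are fixed before [n] is chosen, so that [no_pump] applies to [u2] or [v2]. *)
have [u2 [v2 [H2 hu2 hv2]]] := chain 2 0.
apply: (@pump_false u2 v2).
  by case/orP: hB => h; [left; apply: hu2 | right; apply: hv2].
move=> n; have [un [vn [Hn hun hvn]]] := chain n 2.
have /(typ_le_iter (n + 2) le) [w' Hw' _] := ctx_gen H Hw.
exists x, y, (un ++ w' ++ vn); split.
  by move: (Hxy _ (H2 _ (Hn _ Hw'))); rewrite -!catA.
by case/orP: hB => [/hun|/hvn]; rewrite !occB_cat; lia.
Qed.

(** [Y] climbs through copies of [b], crosses to [X] at the top, and [X] descends through the same
    copies. The last two descents, nearest to [t], give the fixed factor; the earlier ones give the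
    [n] letters. *)
Lemma down_pump X Y t b x y x' y' u v w :
  reach Y t -> ctx t Y [::] Y b x y -> ctx (b ++ t) Y [::] X [::] x' y' ->
  ctx t X b X [::] u v -> hasB u || hasB v ->
  typ_le t (b ++ t) -> gen [:: nt X t] w -> False.
Proof.
move=> rY HY HYX H hB le Hw; pose T n := iter n (cat b) t.
have chain n : forall j, exists u' v',
    [/\ forall w, gen [:: nt X (T j)] w -> gen [:: nt X (T (n + j))] (u' ++ w ++ v'),
        hasB u -> n <= occB B u' & hasB v -> n <= occB B v'].
  elim: n => [|n IH] j.
    by exists [::], [::]; split=> // w'; rewrite cats0.
  have [u1 [v1 [/ctx_gen H1 hu1 hv1]]] := ctx_transfer (typ_le_iter j le) H.
  have [u2 [v2 [H2 hu2 hv2]]] := IH j.+1.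
  exists (u2 ++ u1), (v1 ++ v2); split.
  + move=> w'; rewrite addSnnS => /H1 /H2; by rewrite -!catA.
  + move=> h; move: (hu1 h) (hu2 h); rewrite hasB_occ occB_cat; lia.
  + move=> h; move: (hv1 h) (hv2 h); rewrite hasB_occ occB_cat; lia.
have climb n w' : gen [:: nt Y (T n)] w' ->
    exists p q, gen [:: nt Y t] (p ++ w' ++ q).
  elim: n w' => [|n IH] w' Hw'; first by exists [::], [::]; rewrite cats0.
  have [p1 [q1 [/ctx_gen H1 _ _]]] := ctx_transfer (typ_le_iter n le) HY.
  have [p2 [q2 H2]] := IH _ (H1 _ Hw').
  by exists (p2 ++ p1), (q1 ++ q2); move: H2; rewrite -!catA.
have [p [q Hpq]] := reach_gen rY.
have [u2 [v2 [H2 hu2 hv2]]] := chain 2 0.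
apply: (@pump_false u2 v2).
  by case/orP: hB => h; [left; apply: hu2 | right; apply: hv2].
move=> n; have [un [vn [Hn hun hvn]]] := chain n 2.
(* The crossing lives on [b ++ t]; [T (n + 2)] also has a [b] on top, so [typ_le_cat] compares the
   two. *)
have [|p1 [q1 [/ctx_gen H1 _ _]]] := ctx_transfer (t' := T (n + 2)) _ HYX.
  by rewrite addnS; apply/typ_le_cat/typ_le_iter.
have [p2 [q2 /Hpq H3]] := climb _ _ (H1 _ (Hn _ (H2 _ Hw))).
exists (p ++ p2 ++ p1 ++ un), (vn ++ q1 ++ q2 ++ q), w; split.
  by move: H3; rewrite -!catA.
by case/orP: hB => [/hun|/hvn]; rewrite !occB_cat; lia.
Qed.

(** * Excursions and a bound on their marks *)

(* Excursions: paths starting and ending with the stack [t] that never pop into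
   [t]. The last index counts the steps of the path whose siblings yield a
   letter of [B]. *)
Inductive exc : seq F -> N -> N -> seq A -> seq A -> nat -> Prop :=
  | exc_nil t X : exc t X X [::] [::] 0
  | exc_copy t X r1 Z r2 Y u1 v1 u v m :
      List.In (PCopy F X (r1 ++ inl Z :: r2)) P ->
      gen (ist t r1) u1 -> gen (ist t r2) v1 -> exc t Z Y u v m ->
      exc t X Y (u1 ++ u) (v ++ v1) ((hasB u1 || hasB v1) + m)
  | exc_push t X Z f W r1 X' r2 Y u1 v1 m1 u2 v2 u3 v3 m3 :
      List.In (PPush A X Z f) P -> exc (f :: t) Z W u1 v1 m1 ->
      List.In (PPop W f (r1 ++ inl X' :: r2)) P ->
      gen (ist t r1) u2 -> gen (ist t r2) v2 -> exc t X' Y u3 v3 m3 ->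
      exc t X Y ((u1 ++ u2) ++ u3) (v3 ++ v2 ++ v1)
        (m1 + (hasB u2 || hasB v2) + m3).

Lemma ctx_copy1 t X r1 Z r2 u v :
  List.In (PCopy F X (r1 ++ inl Z :: r2)) P ->
  gen (ist t r1) u -> gen (ist t r2) v -> ctx t X [::] Z [::] u v.
Proof.
by move=> HP Hu Hv; rewrite -[u]cats0 -[v]cat0s;
  exact: (@ctx_copy t X r1 Z r2 [::] u v Z [::] [::] [::] HP Hu Hv (ctx_nil _ _ _)).
Qed.

Lemma ctx_push1 t X Z f :
  List.In (PPush A X Z f) P -> ctx t X [::] Z [:: f] [::] [::].
Proof. by move=> HP; apply: ctx_push HP (ctx_nil _ _ _). Qed.

Lemma ctx_pop1 t X f r1 Z r2 u v :
  List.In (PPop X f (r1 ++ inl Z :: r2)) P ->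
  gen (ist t r1) u -> gen (ist t r2) v -> ctx t X [:: f] Z [::] u v.
Proof.
by move=> HP Hu Hv; rewrite -[u]cats0 -[v]cat0s;
  exact: (@ctx_pop t X f r1 Z r2 [::] u v Z [::] [::] [::] HP Hu Hv (ctx_nil _ _ _)).
Qed.

Lemma ctx_excursion t X Z f W X' u1 v1 u2 v2 :
  List.In (PPush A X Z f) P -> ctx (f :: t) Z [::] W [::] u1 v1 ->
  ctx t W [:: f] X' [::] u2 v2 -> ctx t X [::] X' [::] (u1 ++ u2) (v2 ++ v1).
Proof.
move=> HP /(@ctx_rebase [:: f]) H1 H2.
exact: ctx_push HP (ctx_trans H1 H2).
Qed.

Lemma exc_ctx t X Y u v m : exc t X Y u v m -> ctx t X [::] Y [::] u v.
Proof.
elim=> {t X Y u v m}.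
- by move=> t X; apply: ctx_nil.
- move=> t X r1 Z r2 Y u1 v1 u v m HP H1 H2 _ IH.
  exact: (@ctx_copy t X r1 Z r2 [::] u1 v1 Y [::] u v HP H1 H2 IH).
- move=> t X Z f W r1 X' r2 Y u1 v1 m1 u2 v2 u3 v3 m3 HP _ IH1 HQ H1 H2 _ IH3.
  exact: ctx_trans (ctx_excursion HP IH1 (ctx_pop1 HQ H1 H2)) IH3.
Qed.

Lemma exc_marked t X Y u v m : exc t X Y u v m -> (0 < m) = hasB u || hasB v.
Proof.
elim=> {t X Y u v m} //.
- move=> t X r1 Z r2 Y u1 v1 u v m _ _ _ _; rewrite !hasB_cat.
  by case: (hasB u1) (hasB u) (hasB v1) (hasB v) => [] [] [] [] //=; lia.
- move=> t X Z f W r1 X' r2 Y u1 v1 m1 u2 v2 u3 v3 m3 _ _ IH1 _ _ _ _ IH3.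
  rewrite !hasB_cat !addn_gt0 IH1 IH3 lt0b.
  by case: (hasB u1) (hasB u2) (hasB u3) (hasB v1) (hasB v2) (hasB v3)
    => [] [] [] [] [] [].
Qed.

Lemma exc_trans t X Y Z u v m u' v' m' :
  exc t X Y u v m -> exc t Y Z u' v' m' -> exc t X Z (u ++ u') (v' ++ v) (m + m').
Proof.
move=> H; elim: H u' v' m' => {t X Y u v m}.
- by move=> t X u' v' m'; rewrite cats0.
- move=> t X r1 W r2 Y u1 v1 u v m HP H1 H2 _ IH u' v' m' /IH H.
  by rewrite -catA (catA v') -addnA; apply: exc_copy HP H1 H2 H.
- move=> t X W f W' r1 X' r2 Y u1 v1 m1 u2 v2 u3 v3 m3 HP E1 _ HQ H1 H2 _ IH u' v' m' /IH H.
  rewrite -(catA _ u3) (catA v') -(addnA _ m3).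
  exact: exc_push HP E1 HQ H1 H2 H.
Qed.

Definition stype : finType := ({set N} * {set N})%type.

(* [history Q t X Y]: an excursion from [X] to [Y] on top of [t] is nested in
   longer ones realising every triple of [Q], each time with a letter of [B]
   produced between the two excursions. *)
Definition history (Q : {set N * N * stype}) t X Y : Prop :=
  forall a b T, (a, b, T) \in Q -> exists t0 be u v u' v' w,
    [/\ t = be ++ t0, typ t0 = T, reach a t0, ctx t0 a [::] X be u v &
     [/\ ctx t0 Y be b [::] u' v', (hasB u || hasB v) || (hasB u' || hasB v')
        & gen [:: nt b t0] w]].

(** Otherwise the pair [X], [Y] repeats over two stacks of the same type. A letter of [B] produced
    on the way up allows [up_pump], one produced on the way down allows [down_pump]. *)
Lemma history_notin Q t X Y x y :
  history Q t X Y -> ctx t X [::] Y [::] x y -> (X, Y, typ t) \notin Q.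
Proof.
move=> hQ E; apply/negP => /hQ [t0 [be [u [v [u' [v' [w]]]]]]].
move=> [Et /typ_eq_le le rX H1 [H2 hB Hw]]; subst t.
case/orP: hB => hB.
- exact: up_pump rX H1 hB le (ctx_gen E (ctx_gen H2 Hw)).
- exact: down_pump rX H1 E H2 hB le Hw.
Qed.

Lemma history_nest Q t X Y f X' Y' u v u' v' :
  history Q t X Y -> ctx t X [::] X' [:: f] u v -> ctx t Y' [:: f] Y [::] u' v' ->
  history Q (f :: t) X' Y'.
Proof.
move=> hQ H H' a b T /hQ [t0 [be [u0 [v0 [u1 [v1 [w]]]]]]].
move=> [Et ET ra H1 [H2 hB Hw]]; subst t.
move/ctx_rebase: H => H; move/ctx_rebase: H' => H'.
exists t0, (f :: be), (u0 ++ u), (v ++ v0), (u' ++ u1), (v1 ++ v'), w.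
split=> //; first exact: ctx_trans H1 H.
split=> //; first exact: ctx_trans H' H2.
by move: hB; rewrite !hasB_cat => /orP [] /orP [] ->; rewrite ?orbT.
Qed.

Lemma history_add Q t X Y f X' Y' u v u' v' w :
  history Q t X Y -> ctx t X [::] X' [:: f] u v -> ctx t Y' [:: f] Y [::] u' v' ->
  (hasB u || hasB v) || (hasB u' || hasB v') -> reach X t ->
  gen [:: nt Y t] w -> history ((X, Y, typ t) |: Q) (f :: t) X' Y'.
Proof.
move=> hQ H H' hB rX Hw a b T; rewrite in_setU1 => /orP [/eqP [-> -> ->]|].
  by exists t, [:: f], u, v, u', v', w.
exact: history_nest hQ H H' a b T.
Qed.

Definition visited (V : {set N}) t X : Prop :=
  forall Z, Z \in V -> exists u v,
    [/\ ctx t Z [::] X [::] u v, hasB u || hasB v & reach Z t].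

(** This is [up_pump] with empty [b]. *)
Lemma visited_notin V t X w :
  visited V t X -> gen [:: nt X t] w -> X \notin V.
Proof.
move=> hV Hw; apply/negP => /hV [u [v [H hB rX]]].
exact: (up_pump rX H hB (typ_le_refl (t := t)) Hw).
Qed.

Lemma visited_step V t X X' u v :
  visited V t X -> ctx t X [::] X' [::] u v -> visited V t X'.
Proof.
move=> hV H Z /hV [u' [v' [H' hB rZ]]]; exists (u' ++ u), (v ++ v').
split=> //; first exact: ctx_trans H' H.
by move: hB; rewrite !hasB_cat => /orP [] ->; rewrite ?orbT.
Qed.

Lemma visited_add V t X X' u v :
  visited V t X -> ctx t X [::] X' [::] u v -> hasB u || hasB v -> reach X t ->
  visited (X |: V) t X'.
Proof.
move=> hV H hB rX Z; rewrite in_setU1 => /orP [/eqP ->|]; first by exists u, v.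
exact: visited_step hV H Z.
Qed.

(* [u0] and [v0] surround the part of the excursion before [X]. Once it is marked,
   each further marked move excludes one more nonterminal. *)
Definition marks_le c t X (u0 v0 : seq A) m : Prop :=
  if hasB u0 || hasB v0 then forall V, visited V t X -> m <= #|~: V| * c.+1
  else m <= #|N| * c.+1.

(** A marked move with at most [c.+1] marks is paid for by adding [X] to the visited set. The other
    alternative is a single move that carries all the marks. *)
Lemma marks_le_step c t X X' w u0 v0 u v k m :
  ctx t X [::] X' [::] u v -> (0 < k) = hasB u || hasB v -> reach X t ->
  gen [:: nt X t] w ->
  k <= c.+1 \/ [/\ m = 0, ~~ (hasB u0 || hasB v0) & k <= #|N| * c.+1] ->
  marks_le c t X' (u0 ++ u) (v ++ v0) m -> marks_le c t X u0 v0 (k + m).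
Proof.
move=> H hk rX Hw hc.
have -> : marks_le c t X' (u0 ++ u) (v ++ v0) m =
    if (hasB u0 || hasB v0) || (0 < k)
    then forall V, visited V t X' -> m <= #|~: V| * c.+1
    else m <= #|N| * c.+1.
  rewrite /marks_le hk !hasB_cat.
  by case: (hasB u0) (hasB v0) (hasB u) (hasB v) => [] [] [] [].
rewrite /marks_le; case: (boolP (hasB u0 || hasB v0)) hc => /= [h0|h0] hc IH.
- move=> V hV; have {}hc : k <= c.+1 by case: hc => // -[].
  have [k0|k0] := posnP k; first by rewrite k0; apply/IH/visited_step/H.
  have := IH _ (visited_add hV H (etrans (esym hk) k0) rX).
  by rewrite (card_setC_add (visited_notin hV Hw)); nia.
- have [k0|k0] := posnP k; first by move: IH; rewrite k0.
  move: IH; rewrite k0 => IH.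
  case: hc => [hc|[-> _ hc]]; last by rewrite addn0.
  have v0X : visited set0 t X by move=> Z; rewrite inE.
  have := IH _ (visited_add v0X H (etrans (esym hk) k0) rX).
  have /card_setC_add : X \notin set0 by rewrite inE.
  by rewrite setC0 cardsT => ->; nia.
Qed.

(** The induction parameter [n] bounds the number of triples still missing from the history. *)
Definition exc_bounded n c : Prop := forall Q t X Y u v m w,
  #|~: Q| <= n -> exc t X Y u v m -> reach X t -> history Q t X Y ->
  gen [:: nt Y t] w -> m <= c.

Lemma exc_bounded0 : exc_bounded 0 0.
Proof.
move=> Q t X Y u v m w; rewrite leqn0 => /eqP Q0 /exc_ctx H _ hQ _.
have := history_notin hQ H.
by rewrite -in_setC (cards0_eq Q0) inE.
Qed.

(** An inner excursion with a mark outside it lengthens the history, so it has at most [c] marks,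
    and its closing pop adds at most one. Without such a mark the history stays the same and
    induction on the excursion bounds the inner one. *)
Lemma exc_boundedS n c : exc_bounded n c -> exc_bounded n.+1 (#|N| * c.+1).
Proof.
move=> IHn; suff IH t X Y u v m : exc t X Y u v m -> forall Q X0 u0 v0 w,
    #|~: Q| <= n.+1 -> ctx t X0 [::] X [::] u0 v0 -> reach X0 t ->
    history Q t X0 Y -> gen [:: nt Y t] w -> marks_le c t X u0 v0 m.
  move=> Q t X Y u v m w leQ E rX hQ Hw.
  exact: (IH _ _ _ _ _ _ E Q X [::] [::] w leQ (ctx_nil _ _ _) rX hQ Hw).
elim=> {t X Y u v m}.
- by move=> t X Q X0 u0 v0 w _ _ _ _ _; rewrite /marks_le; case: ifP.
- move=> t X r1 Z r2 Y u1 v1 u v m HP H1 H2 E IH Q X0 u0 v0 w leQ H0 r0 hQ Hw.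
  have Hm := ctx_copy1 HP H1 H2.
  have rX : reach X t := reach_ctx r0 H0.
  apply: (marks_le_step Hm _ rX (ctx_gen Hm (ctx_gen (exc_ctx E) Hw))).
  + by rewrite lt0b.
  + by left; case: (_ || _).
  + exact: IH leQ (ctx_trans H0 Hm) r0 hQ Hw.
- move=> t X Z f W r1 X' r2 Y u1 v1 m1 u2 v2 u3 v3 m3 HP E1 IH1 HQ H1 H2 E3 IH3.
  move=> Q X0 u0 v0 w leQ H0 r0 hQ Hw.
  have Hp := ctx_pop1 HQ H1 H2.
  have Hm := ctx_excursion HP (exc_ctx E1) Hp.
  have rX : reach X t := reach_ctx r0 H0.
  have HX' := ctx_gen (exc_ctx E3) Hw.
  have HZ := ctx_trans H0 (ctx_push1 t HP).
  have HW := ctx_trans Hp (exc_ctx E3).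
  have rZ : reach Z (f :: t) := reach_ctx r0 HZ.
  have gW := ctx_gen Hp HX'.
  apply: (marks_le_step Hm _ rX (ctx_gen Hm HX')); last first.
  + exact: IH3 leQ (ctx_trans H0 Hm) r0 hQ Hw.
  (* [l] tells whether the whole excursion from [X0] to [Y] has a letter of [B] produced outside the
     inner excursion [E1]. *)
  + set l := (hasB (u0 ++ [::]) || hasB ([::] ++ v0)) ||
             (hasB (u2 ++ u3) || hasB (v3 ++ v2)).
    have [loss|] := boolP l.
      left; suff: m1 <= c by case: (_ || _); lia.
      apply: IHn E1 rZ (history_add hQ HZ HW loss r0 Hw) gW.
      (* The triple of the whole excursion is new, so fewer triples remain. *)
      have nQ := history_notin hQ (ctx_trans H0 (ctx_trans Hm (exc_ctx E3))).
      by rewrite -ltnS (leq_trans _ leQ) // -(card_setC_add nQ).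
    rewrite /l cats0 !hasB_cat !negb_or => /andP [/andP [h0 h0'] /andP []].
    move=> /andP [h2 h3] /andP [h3' h2']; right; split.
    * have := exc_marked E3; rewrite (negbTE h3) (negbTE h3').
      by case: (m3).
    * by rewrite (negbTE h0).
    * rewrite (negbTE h2) (negbTE h2') addn0.
      exact: IH1 leQ (ctx_nil _ _ _) rZ (history_nest hQ HZ HW) gW.
  + rewrite addn_gt0 (exc_marked E1) lt0b !hasB_cat.
    by case: (hasB u1) (hasB u2) (hasB v1) (hasB v2) => [] [] [] [].
Qed.

Lemma exc_marks : exists c, forall t X Y u v m w,
  exc t X Y u v m -> reach X t -> gen [:: nt Y t] w -> m <= c.
Proof.
have [c Hc] : exists c, exc_bounded #|{: N * N * stype}| c.
  elim: #|_| => [|n [c Hc]]; first by exists 0; apply: exc_bounded0.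
  by exists (#|N| * c.+1); apply: exc_boundedS.
exists c => t X Y u v m w E rX Hw; apply: (Hc set0 _ _ _ _ _ _ _ _ E rX _ Hw).
  by rewrite setC0 cardsT.
by move=> a b T; rewrite inE.
Qed.

(** * Marks on paths that never pop into their initial stack *)

(* Paths that never pop into their initial stack, cut where they leave each
   level for the last time. *)
Inductive gpath : seq F -> N -> nat -> Prop :=
  | gpath_end t X Y u v m w :
      exc t X Y u v m -> gen [:: nt Y t] w -> gpath t X m
  | gpath_push t X Z Z' f u v m m' :
      exc t X Z u v m -> List.In (PPush A Z Z' f) P -> gpath (f :: t) Z' m' ->
      gpath t X (m + m').

Lemma gpath_gen t X m : gpath t X m -> exists w, gen [:: nt X t] w.
Proof.
elim=> {t X m} [t X Y u v m w /exc_ctx E Hw|t X Z Z' f u v m m' /exc_ctx E HP _ [w Hw]].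
  by exists (u ++ w ++ v); apply: (ctx_gen E).
exists (u ++ ([::] ++ w ++ [::]) ++ v).
exact: (ctx_gen E (ctx_gen (ctx_push1 t HP) Hw)).
Qed.

Definition below (V : {set N * stype}) t X : Prop :=
  forall Z T, (Z, T) \in V -> exists t0 be u v,
    [/\ t = be ++ t0, typ t0 = T, reach Z t0, ctx t0 Z [::] X be u v
       & hasB u || hasB v].

(** A nonterminal recurring on a higher stack of the same type, with a mark in between, can be
    pumped by [up_pump]. *)
Lemma below_notin V t X w :
  below V t X -> gen [:: nt X t] w -> (X, typ t) \notin V.
Proof.
move=> hV Hw; apply/negP => /hV [t0 [be [u [v]]]].
move=> [Et /typ_eq_le le rX H hB]; subst t.
exact: up_pump rX H hB le Hw.
Qed.

Lemma below_step V t X Y sg u v :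
  below V t X -> ctx t X [::] Y sg u v -> below V (sg ++ t) Y.
Proof.
move=> hV H Z T /hV [t0 [be [u0 [v0 [Et ET rZ H0 hB]]]]]; subst t.
exists t0, (sg ++ be), (u0 ++ u), (v ++ v0); split=> //; first by rewrite catA.
- exact: ctx_trans H0 (ctx_rebase H).
- by move: hB; rewrite !hasB_cat => /orP [] ->; rewrite ?orbT.
Qed.

(** Each excursion of the path has at most [c] marks, and each marked one uses up a new pair of a
    nonterminal and a stack type. *)
Lemma gpath_marks : exists M, forall t X m, gpath t X m -> reach X t -> m <= M.
Proof.
have [c Hc] := exc_marks; exists (#|{: N * stype}| * c).
suff IH t X m : gpath t X m -> forall V, below V t X -> reach X t -> m <= #|~: V| * c.
  move=> t X m H rX; have := IH _ _ _ H set0; rewrite setC0 cardsT; apply=> //.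
  by move=> Z T; rewrite inE.
elim=> {t X m}.
- move=> t X Y u v m w E Hw V hV rX.
  have nV := below_notin hV (ctx_gen (exc_ctx E) Hw).
  by apply: leq_trans (Hc _ _ _ _ _ _ _ E rX Hw) _; rewrite (card_setC_add nV) mulSn leq_addr.
- move=> t X Z Z' f u v m m' E HP G IH V hV rX.
  have [w Hw] := gpath_gen G.
  have HZ := ctx_gen (ctx_push1 t HP) Hw.
  have H := ctx_trans (exc_ctx E) (ctx_push1 t HP).
  have rZ' : reach Z' (f :: t) := reach_ctx rX H.
  have lem := Hc _ _ _ _ _ _ _ E rX HZ.
  have [m0|m0] := posnP m; first by rewrite m0; apply: IH (below_step hV H) rZ'.
  have nV := below_notin hV (ctx_gen (exc_ctx E) HZ).
  rewrite (card_setC_add nV) mulSn leq_add //; apply: IH => // Y T.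
  rewrite in_setU1 => /orP [/eqP [-> ->]|]; last exact: (below_step hV H).
  exists t, [:: f], (u ++ [::]), ([::] ++ v); split=> //.
  by rewrite cats0 -(exc_marked E).
Qed.

(** * Arbitrary paths *)

(* Arbitrary paths, cut where they first pop into each level of their initial
   stack. *)
Inductive dpath : seq F -> N -> nat -> Prop :=
  | dpath_gpath t X m : gpath t X m -> dpath t X m
  | dpath_pop f t X W r1 X' r2 u v m u' v' m' :
      exc (f :: t) X W u v m -> List.In (PPop W f (r1 ++ inl X' :: r2)) P ->
      gen (ist t r1) u' -> gen (ist t r2) v' -> dpath t X' m' ->
      dpath (f :: t) X (m + ((hasB u' || hasB v') + m')).

Lemma dpath_root X m : dpath [::] X m -> gpath [::] X m.
Proof. by move Et: [::] => t D; case: D Et. Qed.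

Lemma dpath_exc t X Y u v m m' :
  exc t X Y u v m -> dpath t Y m' -> dpath t X (m + m').
Proof.
move=> E D; case: D E => {t Y m'}.
- move=> t Y m' [{}t {}Y Z u' v' {}m' w E' Hw E|{}t {}Y Z Z' f u' v' m1 m2 E' HP G E].
    exact: dpath_gpath (gpath_end (exc_trans E E') Hw).
  by rewrite addnA; apply: dpath_gpath (gpath_push (exc_trans E E') HP G).
- move=> f t Y W r1 X' r2 u1 v1 m1 u2 v2 m2 E' HP H1 H2 D E.
  by rewrite addnA; apply: dpath_pop (exc_trans E E') HP H1 H2 D.
Qed.

Lemma dpath_copy t X r1 Z r2 u v m :
  List.In (PCopy F X (r1 ++ inl Z :: r2)) P ->
  gen (ist t r1) u -> gen (ist t r2) v -> dpath t Z m ->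
  dpath t X ((hasB u || hasB v) + m).
Proof.
move=> HP Hu Hv; rewrite -[nat_of_bool _]addn0; apply: dpath_exc.
exact: exc_copy HP Hu Hv (exc_nil _ _).
Qed.

(** If the path later pops the pushed [f], the push, the excursion above it and the pop merge into
    one excursion over [t]. *)
Lemma dpath_push t X Z f m :
  List.In (PPush A X Z f) P -> dpath (f :: t) Z m -> dpath t X m.
Proof.
move=> HP; move Et: (f :: t) => t' D; case: D HP Et => {t' Z m}.
- move=> t' Z m G HP Et; subst t'; apply: dpath_gpath.
  exact: (gpath_push (exc_nil t X) HP G).
- move=> g t' Z W r1 X' r2 u v m u' v' m' E HQ H1 H2 D HP [Ef Et]; subst g t'.
  have E' := exc_push HP E HQ H1 H2 (exc_nil t X').
  by move: (dpath_exc E' D); rewrite addn0 -addnA.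
Qed.

(** * From many letters of [B] to many marks on a path *)

Lemma inst_split st rhs s1 Z st' s2 :
  ist st rhs = s1 ++ nt Z st' :: s2 -> exists r1 r2,
  [/\ rhs = r1 ++ inl Z :: r2, st' = st, s1 = ist st r1 & s2 = ist st r2].
Proof.
elim: rhs s1 => [|x rhs IH] [|y s1] //=; case: x => [Y|a] //.
- by case=> -> -> <-; exists [::], rhs.
- case=> <- /IH [r1 [r2 [-> -> -> ->]]]; by exists (inl Y :: r1), r2.
- case=> <- /IH [r1 [r2 [-> -> -> ->]]]; by exists (inr a :: r1), r2.
Qed.

Variable R : nat.

(* Descending to [X] multiplies the bound by [size s] only if the step is
   marked. *)
Definition heavy (s : form) (w : seq A) : Prop :=
  occB B w <= size s \/ exists s1 X st s2 u v m,
    [/\ s = s1 ++ nt X st :: s2, gen s1 u, gen s2 v &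
     [/\ dpath st X m, occB B w <= size s * R ^ m.+1
        & occB B w <= R ^ m.+1 \/ hasB u || hasB v]].

(** Of the head and the symbol chosen in [s], the one whose path has more marks is kept; its power
    of [R] also bounds the letters of the other. *)
Lemma heavy_cons X st s w1 w2 m : 0 < R ->
  dpath st X m -> occB B w1 <= R ^ m.+1 -> gen [:: nt X st] w1 -> gen s w2 ->
  heavy s w2 -> heavy (nt X st :: s) (w1 ++ w2).
Proof.
move=> R0 D le1 H1 H2 hs.
have pR k : 0 < R ^ k by rewrite expn_gt0 R0.
have pick : occB B w2 <= size s * R ^ m.+1 -> heavy (nt X st :: s) (w1 ++ w2).
  move=> le2; right; exists [::], X, st, s, [::], w2, m; split=> //.
    exact: gen_nil.
  split=> //; rewrite occB_cat; first by rewrite /= mulSn leq_add.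
  rewrite /= hasB_occ; have [->|] := posnP (occB B w2); last by right.
  by left; rewrite addn0.
case: hs => [le2|]; first by apply: pick; rewrite (leq_trans le2) // leq_pmulr.
move=> [s1 [Y [st' [s2 [u [v [m' [Es Hu Hv [D' le2 hB]]]]]]]]].
have [lem|lem] := leqP m' m.
  apply: pick; apply: leq_trans le2 _; rewrite leq_mul2l leq_pexp2l ?orbT //.
right; exists (nt X st :: s1), Y, st', s2, (w1 ++ u), v, m'.
split=> //; [by rewrite Es | exact: (gen_cat H1 Hu) |].
split=> //; rewrite occB_cat.
- rewrite /= mulSn leq_add // (leq_trans le1) // leq_pexp2l // ltnW //.
- rewrite hasB_cat (hasB_occ w1); have [->|w10] := posnP (occB B w1).
    by case: hB; [left | right].
  by right.
Qed.

Hypothesis R0 : 0 < R.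
Hypothesis RP : forall X rhs, List.In (PCopy F X rhs) P -> size rhs <= R.
Hypothesis RQ : forall X f rhs, List.In (PPop X f rhs) P -> size rhs <= R.

Lemma dpath_nil t X w : gen [:: nt X t] w -> dpath t X 0.
Proof. by move=> Hw; apply: dpath_gpath (gpath_end (exc_nil t X) Hw). Qed.

(** Choosing one symbol of a right-hand side costs a factor of at most [R], which the mark of that
    step pays for. *)
Lemma gen_heavy s w : gen s w -> heavy s w.
Proof.
elim=> {s w}.
- by left.
- move=> a s w Hs [le|].
    by left; rewrite -cat1s occB_cat /= -add1n leq_add // /occB /= addn0 leq_b1.
  move=> [s1 [Y [st' [s2 [u [v [m [Es Hu Hv [D le hB]]]]]]]]]; right.
  exists (tm a :: s1), Y, st', s2, (a :: u), v, m.
  split=> //; [by rewrite Es | exact: gen_tm |].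
  have pR : 0 < R ^ m.+1 by rewrite expn_gt0 R0.
  split=> //; rewrite -(cat1s a w) occB_cat.
    by rewrite /= mulSn leq_add // (leq_trans _ pR) // /occB /= addn0 leq_b1.
  rewrite -(cat1s a u) hasB_cat (hasB_occ [:: a]); have [->|a1] := posnP (occB B [:: a]); last by right.
  by case: hB; [left | right].
- move=> X st rhs s w1 w2 HP H1 hs1 H2 hs2.
  have H : gen [:: nt X st] w1.
    by rewrite -[w1]cats0; apply: gen_copy HP H1 gen_nil.
  case: hs1 => [le|].
    apply: (heavy_cons R0 (dpath_nil H)) => //; rewrite expn1.
    by apply: leq_trans le _; rewrite size_map (RP HP).
  move=> [s1 [Z [st' [s2 [u [v [m [Es Hu Hv [D le hB]]]]]]]]].
  have [r1 [r2 [Er Est Es1 Es2]]] := inst_split Es; subst st' s1 s2.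
  have szR := RP HP; rewrite Er in HP.
  apply: (heavy_cons R0 (dpath_copy HP Hu Hv D)) => //.
  (* Without a mark the exponent may not grow, but then the chosen symbol alone accounts for all
     letters of [B]. *)
  case: (hasB u || hasB v) hB => [_|[]//].
  rewrite add1n expnS (leq_trans le) // size_map leq_mul2r szR orbT //.
- move=> X Y f st s w1 w2 HP H1 hs1 H2 hs2.
  have H : gen [:: nt X st] w1.
    by rewrite -[w1]cats0; apply: gen_push HP H1 gen_nil.
  case: hs1 => [le|].
    apply: (heavy_cons R0 (dpath_nil H)) => //; rewrite expn1.
    exact: leq_trans le _.
  move=> [s1 [Z [st' [s2 [u [v [m [Es _ _ [D le _]]]]]]]]].
  case: s1 Es => [|? []] //= [EY Est _]; subst Z st'.
  apply: (heavy_cons R0 (dpath_push HP D)) => //.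
  by rewrite /= mul1n in le.
- move=> X f st rhs s w1 w2 HP H1 hs1 H2 hs2.
  have H : gen [:: nt X (f :: st)] w1.
    by rewrite -[w1]cats0; apply: gen_pop HP H1 gen_nil.
  case: hs1 => [le|].
    apply: (heavy_cons R0 (dpath_nil H)) => //; rewrite expn1.
    by apply: leq_trans le _; rewrite size_map (RQ HP).
  move=> [s1 [Z [st' [s2 [u [v [m [Es Hu Hv [D le hB]]]]]]]]].
  have [r1 [r2 [Er Est Es1 Es2]]] := inst_split Es; subst st' s1 s2.
  have szR := RQ HP; rewrite Er in HP.
  apply: (heavy_cons R0 (dpath_pop (exc_nil _ _) HP Hu Hv D)) => //.
  case: (hasB u || hasB v) hB => [_|[]//].
  rewrite add0n add1n expnS (leq_trans le) // size_map leq_mul2r szR orbT //.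
Qed.

(** The start symbol has an empty stack, so its path is a [gpath] and has at most [M] marks. *)
Lemma gen_bounded : exists c, forall w, gen [:: nt S [::]] w -> occB B w <= c.
Proof.
have [M HM] := gpath_marks; exists (R ^ M.+1) => w /gen_heavy [le|].
  by apply: leq_trans le _; rewrite expn_gt0 R0.
move=> [s1 [Z [st' [s2 [u [v [m [Es _ _ [D le _]]]]]]]]].
case: s1 Es => [|? []] //= [EZ Est _]; subst Z st'.
move: le; rewrite /= mul1n => /leq_trans; apply; rewrite leq_pexp2l // ltnS.
apply: (HM _ _ _ (dpath_root D)).
by exists [::], [::]; apply: ctx_nil.
Qed.

End NoPump.

End Derivations.

(** * Application to rare sets *)

Lemma rhs_bounded (N F A : Type) (P : seq (iprod N F A)) : exists2 R, 0 < R &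
  (forall X rhs, List.In (PCopy F X rhs) P -> size rhs <= R) /\
  (forall X f rhs, List.In (PPop X f rhs) P -> size rhs <= R).
Proof.
elim: P => [|p P [R R0 [H1 H2]]]; first by exists 1.
pose k := match p with PCopy _ r => size r | PPush _ _ _ => 0 | PPop _ _ r => size r end.
exists (maxn k R); first by rewrite leq_max R0 orbT.
split=> [X rhs|X f rhs] /=; rewrite leq_max.
- by case=> [Ep|/H1 ->]; [rewrite /k Ep leqnn | rewrite orbT].
- by case=> [Ep|/H2 ->]; [rewrite /k Ep leqnn | rewrite orbT].
Qed.

Lemma occB_two (A : finType) (B : {set A}) (g : seq A) a0 : 1 < occB B g ->
  exists i j, [/\ i < j, j < size g, nth a0 g i \in B & nth a0 g j \in B].
Proof.
elim: g => // a g IH; rewrite /occB /=; have [aB|aB] := boolP (a \in B).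
- rewrite add1n ltnS -has_count => /(has_nthP a0) [j jg jB].
  by exists 0, j.+1.
- by rewrite add0n => /IH [i [j [ij jg iB jB]]]; exists i.+1, j.+1.
Qed.

Theorem theorem2 (A : finType) (L : seq A -> Prop) (B : {set A}) :
  indexed_language L -> rare L B -> nonfrequent L B.
Proof.
move=> [G HG] rL.
have [R R0 [RP RQ]] := rhs_bounded (ig_prods G).
have LP w : L w <-> gen (ig_prods G) [:: @NT _ (ig_flag G) A (ig_start G) [::]] w.
  by rewrite HG; split; [apply: iderives_gen | apply: gen_iderives].
have [|c Hc] := @gen_bounded _ _ _ (ig_prods G) B (ig_start G) _ R R0 RP RQ.
  move=> g g2; have g0 : 0 < size g.
    exact: leq_trans (ltnW g2) (count_size _ _).
  (* Two letters of [B] inside [g] are less than [size g] apart, so rarity with [k = size g]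
     excludes words that contain [g] and have [n] or more letters of [B]. *)
  have [n [_ Hn]] := rL (size g) g0; exists n => p q /LP Lw.
  rewrite ltnNge; apply/negP => /(Hn _ Lw) H.
  have a0 : A by case: (g) g0.
  have [i [j [ij jg iB jB]]] := occB_two a0 g2.
  have nthE k : k < size g -> nth a0 (p ++ g ++ q) (size p + k) = nth a0 g k.
    by move=> kg; rewrite nth_cat ltnNge leq_addr /= addKn nth_cat kg.
  have := H a0 (size p + i) (size p + j).
  rewrite !nthE ?(ltn_trans ij) // !size_cat => /(_ _ _ iB jB).
  by move=> H'; have := H' ltac:(lia) ltac:(lia); lia.
by exists c => w /LP; apply: Hc.
Qed.
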